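(* Let $s\in(0,1)$, $n\ge 1$, and $2<q<\frac{2^*_n+2}{2}$. There exists a positive constant $K_\infty=K_\infty(n,s,q)$, depending only on $n$, $s$, and $q$, such that for every $d>0$ and every solution $u\in H^s_{B,0}$ (in the weak sense specified in the context) of \[ \begin{cases} d(-\Delta)^s u+u=u^{q-1}&\text{in }B,\\ u\ge 0&\text{in }B,\\ \mathcal N_s u=0&\text{in }\mathbb R^n\setminus \overline B, \end{cases} \] the following estimate holds: \[ \|u\|_{L^\infty(B)}\le K_\infty\max\left\{1,\frac{1}{d^{\Lambda_q}}\right\},\qquad \Lambda_q:=\begin{cases}\frac{2^*_n}{2^*_n-2(q-1)}&\text{if }2^*_n<\infty,\\ 1&\text{otherwise.}\end{cases} \]
   Context: $B$ is the open unit ball of $\mathbb R^n$ centered at the origin, and $B^c=\mathbb R^n\setminus B$. The critical exponent is $2^*_n:=\frac{2n}{n-2s}$ if $0<s<\frac n2$, and $2^*_n:=+\infty$ if $s\ge \frac n2$ (in the latter case the condition $q<\frac{2_n^*+2}{2}$ is void). The fractional Laplacian is $(-\Delta)^su(x):=c_{n,s}\,\mathrm{PV}\int_{\mathbb R^n}\frac{u(x)-u(y)}{|x-y|^{n+2s}}dy$, with $c_{n,s}>0$ the usual normalization constant depending only on $n,s$, and the nonlocal normal derivative is $\mathcal N_s u(x):=c_{n,s}\int_B\frac{u(x)-u(y)}{|x-y|^{n+2s}}dy$ for $x\in\mathbb R^n\setminus\overline B$. For measurable $u:\mathbb R^n\to\mathbb R$ set \[ [u]_{H^s_{B,0}}:=\left(\frac{c_{n,s}}{2}\iint_{\mathbb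 R^{2n}\setminus(B^c)^2}\frac{|u(x)-u(y)|^2}{|x-y|^{n+2s}}dx\,dy\right)^{1/2}, \] and $H^s_{B,0}:=\{u:\mathbb R^n\to\mathbb R \text{ measurable}: u\in L^2(B),\ [u]_{H^s_{B,0}}<\infty\}$, with norm $\|u\|_{H^s_{B,0}}=(\|u\|_{L^2(B)}^2+[u]^2_{H^s_{B,0}})^{1/2}$. A (weak) solution of the problem is a non-negative function $u\in H^s_{B,0}$ such that for every $v\in H^s_{B,0}$ (the integral on the right being finite) \[ d\,\frac{c_{n,s}}{2} \iint_{\mathbb R^{2n}\setminus(B^c)^2}\frac{(u(x)-u(y))(v(x)-v(y))}{|x-y|^{n+2s}}\,dx\,dy + \int_B u\, v\,dx=\int_B u^{q-1}v\, dx. \] *)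

(* Defs.v *)
From HB Require Import structures.
From mathcomp Require Import all_boot all_order all_algebra.
From mathcomp Require Import all_classical all_reals all_analysis.
From mathcomp Require Import measurable_realfun ess_sup_inf.

Set Implicit Arguments.
Unset Strict Implicit.
Unset Printing Implicit Defensive.

Import Order.TTheory GRing.Theory Num.Def Num.Theory.
Import numFieldNormedType.Exports.

Local Open Scope classical_set_scope.
Local Open Scope ring_scope.

(* Lebesgue measure on the Borel sets of [R^n], by induction on [n]: the
   image of the product measure on [R * R^n] under [(x, t) |-> x :: t]. *)
Section borel_lebesgue.
Context {R : realType}.
Local Notation T n := (n.-tuple (measurableTypeR R)).

Definition tcons n (p : measurableTypeR R * T n) : T n.+1 :=
  [tuple of p.1 :: p.2].

Lemma measurable_tcons n : measurable_fun setT (@tcons n).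
Proof. exact: (measurable_cons measurable_fst measurable_snd). Qed.

Section step.
Variables (n : nat) (m : {sigma_finite_measure set (T n) -> \bar R}).

Definition lebesgue_step : set (T n.+1) -> \bar R :=
  pushforward (lebesgue_measure \x m)%E (@tcons n).

Let m0 : lebesgue_step set0 = 0%E.
Proof. by rewrite /lebesgue_step /pushforward preimage_set0 measure0. Qed.

Let m_ge0 A : (0 <= lebesgue_step A)%E.
Proof. exact: (measure_ge0 (lebesgue_measure \x m)%E). Qed.

Let m_sigma_additive : semi_sigma_additive lebesgue_step.
Proof.
have mt := @measurable_tcons n.
move=> F mF tF mUF; rewrite /lebesgue_step /pushforward preimage_bigcup.
apply: measure_semi_sigma_additive.
- by move=> k; rewrite -[X in measurable X]setTI; exact: mt.
- apply/trivIsetP => /= i j _ _ ij; rewrite -preimage_setI.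
  by move/trivIsetP : tF => /(_ _ _ _ _ ij) ->//; rewrite preimage_set0.
- by rewrite -preimage_bigcup -[X in measurable X]setTI; exact: mt.
Qed.

HB.instance Definition _ := isMeasure.Build _ _ _ lebesgue_step
  m0 m_ge0 m_sigma_additive.

Let m_sigma_finite : sigma_finite setT lebesgue_step.
Proof.
have /sigma_finiteP[F [TF ndF Foo]] :=
  sigma_finiteT (lebesgue_measure : {sigma_finite_measure set _ -> \bar R}).
have /sigma_finiteP[G [TG ndG Goo]] := sigma_finiteT m.
pose uncons (t : T n.+1) : measurableTypeR R * T n :=
  (tnth t ord0, [tuple of behead t]).
have unconsK : cancel uncons (@tcons n).
  by move=> t; rewrite /tcons/= [RHS]tuple_eta; apply: val_inj.
have tconsK : cancel (@tcons n) uncons.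
  by case=> x t; rewrite /uncons/= (tnth_nth x)/=; congr (_, _); apply: val_inj.
have munc : measurable_fun setT uncons.
  apply/measurable_fun_pairP; split => /=; first exact: measurable_tnth.
  exact: measurable_behead.
exists (fun k => uncons @^-1` (F k `*` G k)).
  apply/esym; rewrite -subTset => t _.
  have [k _ Ft] : (\bigcup_k F k) (tnth t ord0) by rewrite -TF.
  have [l _ Gt] : (\bigcup_k G k) [tuple of behead t] by rewrite -TG.
  exists (maxn k l) => //; split => /=.
    by move: Ft; exact/subsetPset/ndF/leq_maxl.
  by move: Gt; exact/subsetPset/ndG/leq_maxr.
move=> k; have [mF Fk] := Foo k; have [mG Gk] := Goo k; split.
  by rewrite -[X in measurable X]setTI; apply: munc => //; exact: measurableX.
rewrite /lebesgue_step /pushforward -comp_preimage.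
rewrite (_ : uncons \o _ = id); last exact/funext.
by rewrite preimage_id product_measure1E// lte_mul_pinfty// ge0_fin_numE.
Qed.

HB.instance Definition _ := Measure_isSigmaFinite.Build _ _ _ lebesgue_step
  m_sigma_finite.

End step.

Fixpoint borel_lebesgue n : {sigma_finite_measure set (T n) -> \bar R} :=
  match n with
  | 0 => dirac ([tuple] : T 0)
  | n'.+1 => lebesgue_step (borel_lebesgue n')
  end.

End borel_lebesgue.
Arguments borel_lebesgue R n : clear implicits.

(* Lebesgue-measurable sets: the Caratheodory sigma-algebra completes the
   Borel one. *)
Definition Rn (R : realType) (n : nat) : Type :=
  caratheodory_type ((borel_lebesgue R n)^*)%mu.
HB.instance Definition _ (R : realType) (n : nat) :=
  Measurable.on (Rn R n).

Definition lebesgue (R : realType) (n : nat) : set (Rn R n) -> \bar R :=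
  completed_measure_extension (mu := borel_lebesgue R n).
HB.instance Definition _ (R : realType) (n : nat) :=
  Measure.on (@lebesgue R n).
HB.instance Definition _ (R : realType) (n : nat) :=
  Measure_isSigmaFinite.Build _ _ _ (@lebesgue R n)
    (completed_measure_extension_sigma_finite
      (sigma_finiteT (borel_lebesgue R n))).

Section problem.
Context {R : realType} {n : nat}.
Implicit Types (x y : Rn R n) (u v : Rn R n -> R) (s q d : R).

Local Notation mu := (@lebesgue R n).

Definition coord x (i : 'I_n) : R := tnth (x : n.-tuple R) i.

Definition edist x y : R :=
  Num.sqrt (\sum_(i < n) (coord x i - coord y i) ^+ 2).

Definition enorm x : R := Num.sqrt (\sum_(i < n) coord x i ^+ 2).

Definition B : set (Rn R n) := [set x | enorm x < 1].

Lemma measurable_B : measurable B.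
Proof.
have sqrt_lt1 (a : R) : (Num.sqrt a < 1) = (a < 1).
  by rewrite -[in LHS]sqrtr1 ltr_sqrt.
have mc i : measurable_fun setT
    (fun x : n.-tuple (measurableTypeR R) => tnth x i : R).
  exact: measurable_tnth.
have me : measurable_fun setT
    (fun x : n.-tuple (measurableTypeR R) => \sum_(i < n) (tnth x i : R) ^+ 2).
  by apply: measurable_sum => i; apply: measurable_funX.
apply: caratheodory_measurable_mu_ext.
rewrite -[X in measurable X]setTI.
have -> : B = (fun x : n.-tuple (measurableTypeR R) =>
    \sum_(i < n) (tnth x i : R) ^+ 2) @^-1` `]-oo, 1[%classic.
  by apply/seteqP; split => x; rewrite /B /enorm /= in_itv/= sqrt_lt1.
exact: me.
Qed.

Definition muB : {measure set (Rn R n) -> \bar R} := mrestr mu measurable_B.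

(* The usual normalization of [(-Delta)^s], the one giving it the Fourier
   symbol [|xi|^(2s)]: 1/c = \int (1 - cos z_1) / |z|^(n+2s) dz. *)
Definition c_ns s : R :=
  (\int[mu]_z ((1 - cos (nth 0 (z : n.-tuple R) 0)) /
               enorm z `^ (n%:R + 2 * s)))^-1.

(* R^(2n) \ (B^c)^2 *)
Definition cross : set (Rn R n * Rn R n) := ~` (~` B `*` ~` B).

Definition seminormHB s u : \bar R :=
  (((c_ns s / 2)%:E * \int[(mu \x mu)%E]_(z in cross)
     (`|u z.1 - u z.2| ^+ 2 / edist z.1 z.2 `^ (n%:R + 2 * s))%:E) `^ (2^-1))%E.

Definition HB0 s u : Prop :=
  [/\ measurable_fun setT u,
      ('N[muB]_2%:E[EFin \o u] < +oo)%E &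
      (seminormHB s u < +oo)%E].

Definition formHB s u v : R :=
  c_ns s / 2 * \int[(mu \x mu)%E]_(z in cross)
    ((u z.1 - u z.2) * (v z.1 - v z.2) / edist z.1 z.2 `^ (n%:R + 2 * s)).

(* Weak form of [d (-Delta)^s u + u = u^(q-1)] in [B] together with the nonlocal
   Neumann condition [N_s u = 0] outside the closure of [B]: the latter is
   natural, being encoded by test functions that do not vanish outside [B]. *)
Definition weak_solution s q d u : Prop :=
  [/\ HB0 s u,
      {ae mu, forall x, 0 <= u x} &
      forall v, HB0 s v ->
        mu.-integrable B (EFin \o (fun x => u x `^ (q - 1) * v x)) /\
        d * formHB s u v + \int[mu]_(x in B) (u x * v x) =
        \int[mu]_(x in B) (u x `^ (q - 1) * v x)].

End problem.
Arguments muB R n : clear implicits.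
Arguments c_ns R n s : clear implicits.

Definition crit_exp (R : realType) (n : nat) (s : R) : \bar R :=
  if s < n%:R / 2 then (2 * n%:R / (n%:R - 2 * s))%:E else +oo%E.

Definition Lambda (R : realType) (n : nat) (s q : R) : R :=
  if crit_exp n s is r%:E%E then r / (r - 2 * (q - 1)) else 1.

(* Main.v *)
Require Import Defs.
From mathcomp Require Import all_boot all_order all_algebra.
From mathcomp Require Import all_classical all_reals all_analysis.
From mathcomp Require Import measurable_realfun ess_sup_inf.
From mathcomp Require Import ring lra.

Set Implicit Arguments.
Unset Strict Implicit.
Unset Printing Implicit Defensive.

Import Order.TTheory GRing.Theory Num.Theory.
Import numFieldNormedType.Exports.

Local Open Scope classical_set_scope.
Local Open Scope ring_scope.

(** The bound comes from one De Giorgi iteration on the quantity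
    F(k) = int_(B, u > k) u^(q-1), run with test functions that fit its scaling.

    Write al = 2s/n, la = (q-1) al and de = la - (q-2).  The hypothesis on q says
    exactly that de > 0, and 1/de is Lambda when the critical exponent is finite
    and at most 1 = Lambda otherwise ([subcritical_exponent]).

    Testing the equation with the constant 1 kills the nonlocal term and gives
    int_B u = int_B u^(q-1); as q - 1 > 1 this bounds F by a constant depending on
    n and q only ([mass_le_bound]).

    Testing with v = k^-de - max(u,k)^-de gives the decay.  This v is a bounded,
    nondecreasing, Lipschitz function of u, hence admissible, and the right-hand
    side int u^(q-1) v is at most k^-de F(k).  For the nonlocal term, put
    th = k/h and fix x in B with u(x) > h.  Among the y in B with
    u(y) <= th u(x) the integrand is at least
    de (1-th)^2 u(x)^(1-de) / |x-y|^(n+2s).  The excluded set {u > th u(x)} has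
    measure at most b = (th u(x))^-(q-1) F(k) by Markov's inequality, so it fills
    at most half of B inside a ball around x of volume of order b: what remains
    there contributes b (b^(1/n))^-(n+2s) = b^-al up to a constant
    ([lebesgue_B_eballD], [hole_radius_powR]).  Since 1 - de + la = q - 1, the
    powers of u(x) recombine into u(x)^(q-1), and integrating over x gives
      d (1-th)^2 th^la F(k)^-al F(h) <= C k^-de F(k)
    ([inner_lower], [energy_lower], [mass_step]): the pointwise estimate of the
    kernel mass outside a small set plays the part of a Sobolev inequality.

    The resulting inequality
      F(h) <= (C/d) (1-th)^-2 th^-la k^-de F(k)^(1+al)
    iterates along k_j = k0 (2 - 2^-j) down to F(2 k0) = 0 as soon as k0^de is at least a constant
    over d ([de_giorgi]).  A further constant lower bound on k0 keeps the balls
    above of radius at most 1, so k0 of order max(1, d^(-1/de)) suffices, and then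
    u <= 2 k0 almost everywhere in B.

    If the normalizing constant of the form vanishes, the form is 0 and the weak
    equation says u^(q-1) = u in B, so that u <= 2 there
    ([degenerate_superlevel]). *)

(** * Lebesgue measure of cubes, of the ball, and of balls centred in it *)

(* [coord] and [edist] also name unrelated operations on vectors and metrics *)
Local Notation coord := Defs.coord.
Local Notation edist := Defs.edist.

Section boxes.
Context {R : realType}.

Definition box n (a : nat -> R) (l : R) : set (n.-tuple (measurableTypeR R)) :=
  [set z | forall i : 'I_n, a i <= tnth z i <= a i + l].
Arguments box : clear implicits.

Lemma measurable_box n (a : nat -> R) (l : R) : measurable (box n a l).
Proof.
have -> : box n a l = \bigcap_(i in [set: 'I_n])
    (fun z : n.-tuple (measurableTypeR R) => tnth z i : R) @^-1`
    `[a i, a i + l]%classic.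
  apply/seteqP; split => [z zB i _|z zB i]; rewrite /= ?in_itv/=; first exact: zB.
  by have := zB i I; rewrite /= in_itv.
apply: fin_bigcap_measurable => // i _.
rewrite -[X in measurable X]setTI.
have mi := @measurable_tnth _ (measurableTypeR R) n i.
by apply: mi => //; exact: measurable_itv.
Qed.

(** The measure is built by adding one coordinate at a time, so a cube splits as
    an interval times a cube of one dimension less. *)
Lemma borel_lebesgue_box n (a : nat -> R) (l : R) : 0 <= l ->
  borel_lebesgue R n (box n a l) = (l ^+ n)%:E.
Proof.
move=> l0; elim: n a => [|n IH] a.
  by rewrite /= diracE mem_set ?expr0// => -[].
rewrite /= /lebesgue_step /pushforward.
have -> : (@tcons R n) @^-1` (box n.+1 a l) =
    `[a 0%N, a 0%N + l]%classic `*` box n (fun i => a i.+1) l.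
  apply/seteqP; split => [[x z] /= zB|[x z] /= [xB zB] i].
    split; first by have := zB ord0; rewrite (tnth_nth 0)/= in_itv.
    by move=> i; have := zB (lift ord0 i); rewrite /= !(tnth_nth 0)/=.
  rewrite (tnth_nth 0)/=; move: xB; rewrite in_itv/=.
  case: i => -[|i] //= ilt _.
  by have := zB (Ordinal (ilt : (i < n)%N)); rewrite (tnth_nth 0).
rewrite product_measure1E//; last exact: measurable_box.
rewrite IH [X in (X * _)%E](_ : _ = l%:E); first by rewrite -EFinM exprS.
have -> : l%:E = lebesgue_measure (`[a 0%N, a 0%N + l]%classic : set R).
  rewrite lebesgue_measure_itv/= lte_fin ltrDl.
  case: ltP => [_|l0']; first by rewrite -EFinD addrAC subrr add0r.
  by congr EFin; apply/eqP; rewrite eq_le l0 l0'.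
by [].
Qed.

Variable n : nat.
Local Notation mu := (@lebesgue R n).

Lemma measurable_Rn (A : set (n.-tuple (measurableTypeR R))) :
  measurable A -> measurable (A : set (Rn R n)).
Proof. by move=> mA; exact: caratheodory_measurable_mu_ext. Qed.

Lemma lebesgueE (A : set (n.-tuple (measurableTypeR R))) :
  measurable A -> mu A = borel_lebesgue R n A.
Proof. by move=> mA; exact: measurable_mu_extE. Qed.

Lemma lebesgue_box (a : nat -> R) (l : R) : 0 <= l ->
  mu (box n a l) = (l ^+ n)%:E.
Proof.
by move=> l0; rewrite lebesgueE ?borel_lebesgue_box//; exact: measurable_box.
Qed.

Lemma measurable_coord (i : 'I_n) :
  measurable_fun setT (fun x : Rn R n => coord x i).
Proof.
move=> _ A mA; rewrite setTI; apply: measurable_Rn.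
by rewrite -[X in measurable X]setTI; exact: (measurable_tnth i).
Qed.

Lemma measurable_edist :
  measurable_fun setT (fun z : Rn R n * Rn R n => edist z.1 z.2).
Proof.
have me : measurable_fun setT (fun z : Rn R n * Rn R n =>
    \sum_(i < n) (coord z.1 i - coord z.2 i) ^+ 2).
  apply: measurable_sum => i; apply: measurable_funX; apply: measurable_funB.
    exact: measurableT_comp (measurable_coord i) measurable_fst.
  exact: measurableT_comp (measurable_coord i) measurable_snd.
apply: measurableT_comp me; apply: continuous_measurable_fun.
exact: sqrt_continuous.
Qed.

Lemma edist_gt0 (x y : Rn R n) : x <> y -> 0 < edist x y.
Proof.
move=> xy; rewrite sqrtr_gt0 lt_neqAle sumr_ge0 ?andbT; last first.
  by move=> i _; exact: sqr_ge0.
apply/negP => /eqP/esym/eqP; rewrite psumr_eq0; last by move=> i _; exact: sqr_ge0.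
move=> /allP h; apply: xy; apply: eq_from_tnth => i; apply/eqP.
by have := h i (mem_index_enum _); rewrite /= sqrf_eq0 subr_eq0.
Qed.

Lemma B_sqr (x : Rn R n) : B x <-> \sum_(i < n) coord x i ^+ 2 < 1.
Proof.
have e (a : R) : (Num.sqrt a < 1) = (a < 1) by rewrite -[in LHS]sqrtr1 ltr_sqrt.
by rewrite /B /enorm /= e.
Qed.

Lemma B_sub_box : (B : set (Rn R n)) `<=` box n (fun=> -1) 2.
Proof.
move=> x /B_sqr xB i.
have : coord x i ^+ 2 < 1.
  apply: le_lt_trans xB; rewrite (bigD1 i)//= lerDl.
  by apply: sumr_ge0 => j _; exact: sqr_ge0.
by rewrite /coord; set t := tnth _ _; move=> ?; apply/andP; split; nra.
Qed.

Lemma lebesgue_B : (mu B <= (2 ^+ n)%:E)%E.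
Proof.
rewrite -(lebesgue_box (fun=> -1)) //; apply: le_measure; last exact: B_sub_box.
  by rewrite inE; exact: measurable_B.
by rewrite inE; apply: measurable_Rn; exact: measurable_box.
Qed.

Lemma lebesgue_B_lty : (mu B < +oo)%E.
Proof. by apply: le_lt_trans lebesgue_B _; rewrite ltry. Qed.

Definition eball (x : Rn R n) (r : R) : set (Rn R n) :=
  [set y | edist x y <= r].

Lemma measurable_eball x r : measurable (eball x r).
Proof.
have -> : eball x r = xsection (setT `&`
    (fun z : Rn R n * Rn R n => edist z.1 z.2) @^-1` `]-oo, r]%classic) x.
  by apply/seteqP; split => y; rewrite /xsection /= !inE /= in_itv/=; tauto.
by apply: measurable_xsection; apply: measurable_edist => //; exact: measurable_itv.
Qed.

(** For x in B and e = r/2, the map w |-> (1-e) x + e w contracts B into itself,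
    by convexity, and into the ball of radius r around x.  It sends the cube of
    side 2/n contained in B to a cube of side r/n: this gives a lower bound of the
    volume that does not degenerate when x approaches the boundary of B. *)
Lemma lebesgue_B_eball (x : Rn R n) (r : R) : (0 < n)%N -> B x -> 0 < r -> r <= 1 ->
  (((r / n%:R) ^+ n)%:E <= mu (B `&` eball x r))%E.
Proof.
move=> n0 /B_sqr xB r0 r1.
have n0' : 0 < n%:R :> R by rewrite ltr0n.
pose e := r / 2; have e0 : 0 < e by rewrite /e; lra.
have e1 : e < 1 by rewrite /e; lra.
pose a i := (1 - e) * nth 0 (x : n.-tuple R) i - e / n%:R.
rewrite -(lebesgue_box a); last by rewrite divr_ge0// ltW.
apply: le_measure.
- by rewrite inE; apply: measurable_Rn; exact: measurable_box.
- by rewrite inE; apply: measurableI; [exact: measurable_B|exact: measurable_eball].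
move=> z zb.
(* the preimage of [z] under the contraction *)
pose w i := (coord z i - (1 - e) * coord x i) / e.
have zE i : coord z i = (1 - e) * coord x i + e * w i.
  by rewrite /w mulrCA divff ?gt_eqF// mulr1; ring.
have w2 i : w i ^+ 2 <= n%:R^-1.
  have /andP[] := zb i.
  have -> : r / n%:R = 2 * (e / n%:R) by rewrite /e; field; rewrite gt_eqF.
  rewrite /a -tnth_nth -[tnth z i]/(coord z i) -[tnth x i]/(coord x i) zE => h1 h2.
  have h3 : - n%:R^-1 <= w i.
    by rewrite -(ler_pM2l e0); lra.
  have h4 : w i <= n%:R^-1.
    by rewrite -(ler_pM2l e0); lra.
  have n1 : n%:R^-1 <= 1 :> R by rewrite invf_le1// ler1n.
  have n2 : 0 < n%:R^-1 :> R by rewrite invr_gt0.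
  by nra.
have W : \sum_(i < n) w i ^+ 2 <= 1.
  apply: (le_trans (ler_sum _ (fun i _ => w2 i))).
  by rewrite sumr_const card_ord -[leLHS]mulr_natl mulfV ?gt_eqF.
split.
  apply/B_sqr.
  have : \sum_(i < n) coord z i ^+ 2 <=
      (1 - e) * (\sum_(i < n) coord x i ^+ 2) + e * \sum_(i < n) w i ^+ 2.
    rewrite !mulr_sumr -big_split/=; apply: ler_sum => i _; rewrite zE.
    have : 0 <= e * (1 - e) * (coord x i - w i) ^+ 2.
      by apply: mulr_ge0; [apply: mulr_ge0; lra | exact: sqr_ge0].
    by lra.
  move=> /le_lt_trans; apply.
  by nra.
rewrite /eball /= /edist -(ger0_norm (ltW r0)) -sqrtr_sqr ler_wsqrtr//.
have : \sum_(i < n) (coord x i - coord z i) ^+ 2 <=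
    e ^+ 2 * \sum_(i < n) (2 * coord x i ^+ 2 + 2 * w i ^+ 2).
  rewrite !mulr_sumr; apply: ler_sum => i _; rewrite zE.
  have -> : coord x i - ((1 - e) * coord x i + e * w i) = e * (coord x i - w i).
    by ring.
  by rewrite exprMn ler_wpM2l ?sqr_ge0//; have := sqr_ge0 (coord x i + w i); nra.
move=> /le_trans; apply; rewrite big_split/= -!mulr_sumr.
have -> : r ^+ 2 = e ^+ 2 * 4 by rewrite /e; field.
by rewrite ler_wpM2l ?sqr_ge0//; lra.
Qed.

End boxes.

(** * Truncated negative powers *)

Section truncated_power.
Context {R : realType}.
Implicit Types (k de t U : R).

(** The primitive of de t^-(1+de) that vanishes at k, cut off below k.  The weight is
    integrable at infinity, so this function of t is bounded as well as Lipschitz;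
    it is defined for negative t too, where u may take values on a null set. *)
Definition trunc_pow k de t : R := k `^ (- de) - Num.max k t `^ (- de).

Lemma powRN_le de (x y : R) : 0 <= de -> 0 < x -> x <= y ->
  y `^ (- de) <= x `^ (- de).
Proof.
move=> de0 x0 xy; have y0 := lt_le_trans x0 xy.
rewrite !powRN lef_pV2 ?posrE ?powR_gt0//.
by apply: ge0_ler_powR; rewrite ?nnegrE// ltW.
Qed.

Lemma trunc_pow_eq0 k de t : t <= k -> trunc_pow k de t = 0.
Proof. by move=> tk; rewrite /trunc_pow max_l// subrr. Qed.

Lemma trunc_pow_homo k de t U : 0 < k -> 0 <= de -> t <= U ->
  trunc_pow k de t <= trunc_pow k de U.
Proof.
move=> k0 de0 tU; rewrite /trunc_pow lerD2l lerN2; apply: powRN_le => //.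
  by rewrite lt_max k0.
by rewrite ge_max !le_max lexx tU orbT.
Qed.

Lemma trunc_pow_ge0 k de t : 0 < k -> 0 <= de -> 0 <= trunc_pow k de t.
Proof.
by move=> k0 de0; rewrite /trunc_pow subr_ge0 powRN_le// le_max lexx.
Qed.

Lemma trunc_pow_le k de t : trunc_pow k de t <= k `^ (- de).
Proof. by rewrite /trunc_pow gerBl powR_ge0. Qed.

Lemma ln_le_subr1 (x : R) : 0 < x -> ln x <= x - 1.
Proof. by move=> x0; rewrite lerBrDl -[leRHS]lnK ?posrE// expR_ge1Dx. Qed.

(** The tangent line of the convex function x^-de lies below its graph. *)
Lemma powRN_sub_le de (x y : R) : 0 <= de -> 0 < x -> x <= y ->
  x `^ (- de) - y `^ (- de) <= de * x `^ (- de) / x * (y - x).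
Proof.
move=> de0 x0 xy; have y0 := lt_le_trans x0 xy.
have yx0 : 0 < y / x by rewrite divr_gt0.
have -> : y `^ (- de) = x `^ (- de) * (y / x) `^ (- de).
  by rewrite -powRM ?ltW// mulrCA mulfV ?gt_eqF// mulr1.
have h : 1 - de * (y / x - 1) <= (y / x) `^ (- de).
  rewrite /powR gt_eqF//; apply: le_trans (expR_ge1Dx _).
  by rewrite lerD2l mulNr lerN2 ler_wpM2l// ln_le_subr1.
have p0 : 0 < x `^ (- de) by rewrite powR_gt0.
have -> : de * x `^ (- de) / x * (y - x) = x `^ (- de) * (de * (y / x - 1)).
  by field; rewrite gt_eqF.
rewrite -[X in X - _]mulr1 -mulrBr ler_pM2l//; lra.
Qed.

Lemma trunc_pow_lip k de t U : 0 < k -> 0 <= de ->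
  `|trunc_pow k de t - trunc_pow k de U| <= de * k `^ (- de) / k * `|t - U|.
Proof.
move=> k0 de0; wlog tU : t U / t <= U.
  move=> H; case: (leP t U) => [|/ltW] h; first exact: H.
  by rewrite distrC (distrC t); exact: H.
rewrite distrC ger0_norm ?subr_ge0 ?trunc_pow_homo// distrC ger0_norm ?subr_ge0//.
rewrite [leLHS](_ : _ = Num.max k t `^ (- de) - Num.max k U `^ (- de)); last first.
  by rewrite /trunc_pow; ring.
have m0 : 0 < Num.max k t by rewrite lt_max k0.
have mm : Num.max k t <= Num.max k U by rewrite ge_max !le_max lexx tU orbT.
apply: (le_trans (powRN_sub_le de0 m0 mm)).
have km : k <= Num.max k t by rewrite le_max lexx.
apply: ler_pM => //.
- by rewrite divr_ge0 ?mulr_ge0 ?powR_ge0// ltW.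
- by rewrite subr_ge0.
- apply: ler_pM; rewrite ?mulr_ge0 ?powR_ge0 ?invr_ge0//; first exact: ltW.
    by rewrite ler_wpM2l// powRN_le.
  by rewrite lef_pV2.
- rewrite /Num.max; case: ltP => h1; case: ltP => h2; lra.
Qed.

(** Again the tangent line, now of th^-de at th = 1. *)
Lemma trunc_pow_incr k de th U : 0 < k -> 0 < de -> 0 < th -> th < 1 -> k <= th * U ->
  de * (1 - th) * U `^ (- de) <= trunc_pow k de U - trunc_pow k de (th * U).
Proof.
move=> k0 de0 th0 th1 kU.
have U0 : 0 < U by rewrite -(pmulr_rgt0 _ th0); exact: lt_le_trans kU.
have kU' : k <= U by apply: le_trans kU _; rewrite ger_pMl// ltW.
rewrite /trunc_pow !max_r// powRM; [|exact: ltW|exact: ltW].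
have h : 1 + de * (1 - th) <= th `^ (- de).
  rewrite /powR gt_eqF//; apply: le_trans (expR_ge1Dx _).
  by rewrite lerD2l mulNr -mulrN ler_pM2l// lerNr opprB ln_le_subr1.
have : 0 < U `^ (- de) by rewrite powR_gt0.
by nra.
Qed.

Lemma measurable_trunc_pow k de : measurable_fun setT (trunc_pow k de).
Proof.
apply: measurable_funB; first exact: measurable_cst.
have mm : measurable_fun setT (fun t : R => Num.max k t).
  by apply: measurable_maxr.
exact: (measurableT_comp (measurable_powR (- de)) mm).
Qed.

End truncated_power.

(** * Superlevel sets and the kernel mass outside a small set *)

Section superlevel.
Context {R : realType} {n : nat}.
Variable u : Rn R n -> R.
Hypothesis um : measurable_fun setT u.
Variable q : R.
Hypothesis q2 : 2 < q.
Local Notation mu := (@lebesgue R n).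

Definition superlevel (t : R) : set (Rn R n) := B `&` [set x | t < u x].

Definition mass (t : R) : \bar R :=
  (\int[mu]_(x in superlevel t) (u x `^ (q - 1))%:E)%E.

Lemma measurable_superlevel t : measurable (superlevel t).
Proof.
apply: measurableI; first exact: measurable_B.
have -> : [set x | t < u x] = u @^-1` `]t, +oo[%classic.
  by apply/seteqP; split => x; rewrite /= in_itv/= andbT.
by rewrite -[X in measurable X]setTI; apply: um => //; exact: measurable_itv.
Qed.

Lemma superlevelS t t' : t <= t' -> superlevel t' `<=` superlevel t.
Proof. by move=> tt' x [Bx] /= h; split => //=; exact: le_lt_trans h. Qed.

Lemma measurable_upow (r : R) D : measurable_fun D (fun x => (u x `^ r)%:E).
Proof.
apply: measurable_funTS; apply/measurable_EFinP.
exact: (measurableT_comp (measurable_powR r) um).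
Qed.

Lemma mass_ge0 t : (0 <= mass t)%E.
Proof. by apply: integral_ge0 => x _; rewrite lee_fin powR_ge0. Qed.

Lemma mass_le t t' : t <= t' -> (mass t' <= mass t)%E.
Proof.
move=> tt'; apply: ge0_subset_integral.
- exact: measurable_superlevel.
- exact: measurable_superlevel.
- exact: measurable_upow.
- by move=> x _; rewrite lee_fin powR_ge0.
- exact: superlevelS.
Qed.

Lemma markov_mass t : 0 < t ->
  ((t `^ (q - 1))%:E * mu (superlevel t) <= mass t)%E.
Proof.
move=> t0; rewrite -integral_cst; last exact: measurable_superlevel.
apply: ge0_le_integral.
- exact: measurable_superlevel.
- by move=> x _; rewrite lee_fin powR_ge0.
- exact: measurable_cst.
- exact: measurable_upow.
- move=> x [_ /= tu]; rewrite lee_fin; apply: ge0_ler_powR;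
    rewrite ?nnegrE ?(ltW t0) ?(ltW (lt_trans t0 tu)) ?ltW//.
  by rewrite subr_gt0; apply: lt_trans q2; rewrite ltr1n.
Qed.

Lemma superlevel_le t Y : 0 < t -> (mass t <= Y%:E)%E ->
  (mu (superlevel t) <= (t `^ (- (q - 1)) * Y)%:E)%E.
Proof.
move=> t0 mY; have := le_trans (markov_mass t0) mY.
have p0 : 0 < t `^ (q - 1) by rewrite powR_gt0.
rewrite powRN => h.
rewrite -(@lee_pmul2l _ (t `^ (q - 1))%:E) ?lte_fin//.
by rewrite -EFinM mulrA mulfV ?gt_eqF// mul1r.
Qed.

End superlevel.

Section energy.
Context {R : realType} {n : nat}.
Hypothesis n0 : (0 < n)%N.
Variable s : R.
Hypothesis s0 : 0 < s.
Local Notation mu := (@lebesgue R n).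
Local Notation p := (n%:R + 2 * s).

(** The exact constant in b r^-(n+2s) = [kernel_const] b^(-2s/n) when r is the
    radius defined next. *)
Definition kernel_const : R := n%:R `^ (- p) * 2 `^ (- (p / n%:R)).

(** The radius for which [lebesgue_B_eball] guarantees a volume 2 b, twice the
    measure b of the set to be avoided. *)
Definition hole_radius (b : R) : R := n%:R * (2 * b) `^ n%:R^-1.

Let n0' : 0 < n%:R :> R. Proof. by rewrite ltr0n. Qed.

Lemma exponent_gt0 : 0 < p.
Proof. by rewrite addr_gt0// mulr_gt0. Qed.

Lemma hole_radius_gt0 (b : R) : 0 < b -> 0 < hole_radius b.
Proof. by move=> b0; rewrite mulr_gt0// powR_gt0// mulr_gt0. Qed.

Lemma hole_radius_exp (b : R) : 0 < b -> (hole_radius b / n%:R) ^+ n = 2 * b.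
Proof.
move=> b0; rewrite /hole_radius mulrAC mulfV ?gt_eqF// mul1r -powR_mulrn ?powR_ge0//.
by rewrite -powRrM mulVf ?gt_eqF// powRr1// ltW// mulr_gt0.
Qed.

Lemma hole_radius_powR (b : R) : 0 < b ->
  b * (hole_radius b `^ p)^-1 = kernel_const * b `^ (- (2 * s / n%:R)).
Proof.
move=> b0; have b20 : 0 < 2 * b by rewrite mulr_gt0.
rewrite -powRN /hole_radius powRM ?powR_ge0 ?(ltW n0')// -powRrM powRM ?(ltW b0)//.
rewrite /kernel_const mulrN (mulrC _^-1).
have {1}-> : b = b `^ 1 by rewrite powRr1// ltW.
have -> : - (2 * s / n%:R) = 1 + - (p / n%:R) by field; rewrite gt_eqF.
rewrite (@powRD _ b 1); last by rewrite (gt_eqF b0) implybT.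
ring.
Qed.

(** The largest b with [hole_radius b <= 1], as [lebesgue_B_eball] requires. *)
Definition hole_max : R := (2 * n%:R ^+ n)^-1.

Lemma hole_max_gt0 : 0 < hole_max.
Proof. by rewrite invr_gt0 mulr_gt0// exprn_gt0. Qed.

Lemma hole_radius_le1 (b : R) : 0 < b -> b <= hole_max -> hole_radius b <= 1.
Proof.
move=> b0 bb; rewrite /hole_radius -ler_pdivlMl// mulr1.
have e : n%:R^-1 = (n%:R^-1 ^+ n) `^ n%:R^-1 :> R.
  rewrite -powR_mulrn ?invr_ge0 ?(ltW n0')// -powRrM mulfV ?gt_eqF// powRr1//.
rewrite [leRHS]e.
have h : 2 * b <= n%:R^-1 ^+ n.
  move: bb; rewrite /hole_max invfM exprVn -(ler_pM2l (_ : 0 < 2))//.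
  by rewrite mulrA mulfV// mul1r.
apply: ge0_ler_powR; rewrite ?nnegrE ?invr_ge0 ?(ltW n0')//.
by rewrite ltW// mulr_gt0.
Qed.

(** G takes away at most half of the volume 2 b of B in the ball: this substitute
    for a fractional isoperimetric inequality holds uniformly in x. *)
Lemma lebesgue_B_eballD (x : Rn R n) G (b : R) : measurable G -> B x -> 0 < b ->
  b <= hole_max -> (mu G <= b%:E)%E ->
  (b%:E <= mu ((B `&` eball x (hole_radius b)) `\` G))%E.
Proof.
move=> mG Bx b0 bb Gb; set S := B `&` _.
have mS : measurable S.
  by apply: measurableI; [exact: measurable_B|exact: measurable_eball].
have h : ((2 * b)%:E <= mu S)%E.
  rewrite -hole_radius_exp//; apply: lebesgue_B_eball => //.
    exact: hole_radius_gt0.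
  exact: hole_radius_le1.
have hU : (mu S <= mu (S `\` G) + mu G)%E.
  apply: le_trans (measureU2 _ (measurableD mS mG) mG).
  apply: le_measure; rewrite ?inE//.
    by apply: measurableU => //; exact: measurableD.
  by move=> y Sy; have [Gy|Gy] := pselect (G y); [right|left].
have := le_trans (le_trans h hU) (leeD2l _ Gb).
have -> : (2 * b)%:E = (b%:E + b%:E)%E by rewrite -EFinD; congr EFin; ring.
by rewrite leeD2rE.
Qed.

End energy.

(** * Lower bound for the nonlocal form *)

Section lower_bound.
Context {R : realType} {n : nat}.
Hypothesis n0 : (0 < n)%N.
Variables s q de : R.
Hypotheses (s0 : 0 < s) (q2 : 2 < q).
Local Notation mu := (@lebesgue R n).
Local Notation p := (n%:R + 2 * s).
Local Notation al := (2 * s / n%:R).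
Local Notation la := ((q - 1) * al).
Hypothesis deE : de = la - (q - 2).
Hypothesis de0 : 0 < de.

Definition pairing (u v : Rn R n -> R) (z : Rn R n * Rn R n) : R :=
  (u z.1 - u z.2) * (v z.1 - v z.2) / edist z.1 z.2 `^ p.

Lemma measurable_pairing u v : measurable_fun setT u -> measurable_fun setT v ->
  measurable_fun setT (fun z => (pairing u v z)%:E).
Proof.
have diff (w : Rn R n -> R) : measurable_fun setT w ->
    measurable_fun setT (fun z : Rn R n * Rn R n => w z.1 - w z.2 : R).
  move=> mw; apply: measurable_funB.
    exact: measurableT_comp mw measurable_fst.
  exact: measurableT_comp mw measurable_snd.
move=> um mv; apply/measurable_EFinP.
have -> : pairing u v = (fun z =>
    (u z.1 - u z.2) * (v z.1 - v z.2) * edist z.1 z.2 `^ (- p)).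
  by apply/funext => z; rewrite powRN.
apply: measurable_funM; first by apply: measurable_funM; exact: diff.
exact: (measurableT_comp (measurable_powR (- p)) (@measurable_edist R n)).
Qed.

Lemma measurable_cross : measurable (@cross R n).
Proof.
by apply: measurableC; apply: measurableX; apply: measurableC; exact: measurable_B.
Qed.

Lemma pairing_ge0 u (f : R -> R) z : {homo f : x y / x <= y} ->
  0 <= pairing u (f \o u) z.
Proof.
move=> hf; rewrite /pairing divr_ge0 ?powR_ge0//=.
case: (leP (u z.1) (u z.2)) => [h|/ltW h].
  by rewrite mulr_le0// subr_le0// hf.
by rewrite mulr_ge0// subr_ge0// hf.
Qed.

Variable u : Rn R n -> R.
Hypothesis um : measurable_fun setT u.

(** Only the points y of B near x at which u <= th u(x) are kept in the inner
    integral.  They have measure at least b = (th u(x))^-(q-1) Y, since by Markov's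
    inequality the others have measure at most b in all of B. *)
Lemma inner_lower k th Y (x : Rn R n) : 0 < k -> 0 < th -> th < 1 ->
  B x -> k <= th * u x -> 0 < Y -> (mass u q k <= Y%:E)%E ->
  k `^ (- (q - 1)) * Y <= @hole_max R n ->
  ((@kernel_const R n s * de * (1 - th) ^+ 2 * th `^ la * Y `^ (- al) *
     u x `^ (q - 1))%:E
    <= \int[mu]_(y in B) (pairing u (trunc_pow k de \o u) (x, y))%:E)%E.
Proof.
move=> k0 th0 th1 Bx kU Y0 FY kb.
set U := u x; set t := th * U; pose b := t `^ (- (q - 1)) * Y.
have U0 : 0 < U by rewrite -(pmulr_rgt0 _ th0); exact: lt_le_trans kU.
have t0 : 0 < t by rewrite mulr_gt0.
have b0 : 0 < b by rewrite mulr_gt0// powR_gt0.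
have q1 : 0 <= q - 1.
  by rewrite subr_ge0; apply: ltW; apply: lt_trans q2; rewrite ltr1n.
have bb : b <= @hole_max R n.
  by apply: le_trans kb; rewrite ler_wpM2r ?(ltW Y0)// powRN_le.
have Gb : (mu (superlevel u t) <= b%:E)%E.
  by apply: superlevel_le => //; apply: le_trans FY; apply: mass_le.
have mG := measurable_superlevel um t.
pose S := (B `&` eball x (@hole_radius R n b)) `\` superlevel u t.
have mS : measurable S.
  apply: measurableD => //.
  by apply: measurableI; [exact: measurable_B|exact: measurable_eball].
have Sb : (b%:E <= mu S)%E by exact: lebesgue_B_eballD.
pose m := (1 - th) * U * (de * (1 - th) * U `^ (- de)) *
  (@hole_radius R n b `^ p)^-1.
have m0 : 0 <= m.
  by rewrite /m !mulr_ge0 ?invr_ge0 ?powR_ge0 ?subr_ge0// ltW.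
(* here the choice of [de] matters: [1 - de + la = q - 1] *)
have mb : @kernel_const R n s * de * (1 - th) ^+ 2 * th `^ la * Y `^ (- al) *
    U `^ (q - 1) = m * b.
  have -> : m * b = (1 - th) * U * (de * (1 - th) * U `^ (- de)) *
      (b * (@hole_radius R n b `^ p)^-1).
    by rewrite /m; ring.
  rewrite hole_radius_powR// /b powRM ?powR_ge0 ?(ltW Y0)// -powRrM mulrNN.
  rewrite /t powRM ?(ltW th0) ?(ltW U0)//.
  have -> : U `^ (q - 1) = U * U `^ (- de) * U `^ la.
    rewrite -{2}[U]powRr1 ?(ltW U0)// -!powRD ?(gt_eqF U0) ?implybT//.
    by congr (_ `^ _); rewrite deE; ring.
  by ring.
rewrite mb.
have hpos z : 0 <= pairing u (trunc_pow k de \o u) z.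
  by apply: pairing_ge0 => a c; apply: trunc_pow_homo => //; exact: ltW.
have mp : measurable_fun setT (fun y => (pairing u (trunc_pow k de \o u) (x, y))%:E).
  apply: (measurableT_comp (measurable_pairing um _)).
    exact: measurableT_comp (measurable_trunc_pow _ _) um.
  exact: measurable_pair1.
apply: (@le_trans _ _ (\int[mu]_(y in S) (m%:E))%E).
  by rewrite integral_cst// EFinM lee_wpmul2l// lee_fin.
apply: (@le_trans _ _
  (\int[mu]_(y in S) (pairing u (trunc_pow k de \o u) (x, y))%:E)%E).
  apply: ge0_le_integral.
  - exact: mS.
  - by move=> y _; rewrite lee_fin.
  - exact: measurable_cst.
  - exact: measurable_funTS.
  - move=> y [[By /= xy] Gy].
    (* then [u y < u x], so [x <> y] and the kernel is positive at [(x, y)] *)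
    have uy : u y <= t by rewrite leNgt; apply/negP => h; exact: Gy.
    rewrite lee_fin /m /pairing /= -/U.
    have tU : t < U by rewrite /t gtr_pMl.
    have d0 : 0 < edist x y.
      by apply: edist_gt0 => exy; move: uy; rewrite -exy -/U leNgt tU.
    apply: ler_pM.
    + by rewrite !mulr_ge0 ?subr_ge0 ?powR_ge0// ltW.
    + by rewrite invr_ge0 powR_ge0.
    + apply: ler_pM.
      * by rewrite mulr_ge0 ?subr_ge0// ltW.
      * by rewrite !mulr_ge0 ?subr_ge0 ?powR_ge0// ltW.
      * by rewrite mulrBl mul1r lerD2l lerN2.
      * apply: (le_trans (trunc_pow_incr k0 de0 th0 th1 kU)).
        by rewrite lerD2l lerN2; apply: trunc_pow_homo => //; exact: ltW.
    + rewrite lef_pV2 ?posrE ?powR_gt0//; last exact: hole_radius_gt0.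
      apply: ge0_ler_powR => //; rewrite ?nnegrE ?(ltW d0)//.
        by rewrite ltW// exponent_gt0.
      by rewrite ltW// hole_radius_gt0.
apply: ge0_subset_integral.
- exact: mS.
- exact: measurable_B.
- exact: measurable_funTS.
- by move=> y _; rewrite lee_fin.
- by move=> y [[]].
Qed.

(** Tonelli's theorem on {u > h} x B turns the pointwise bound into one on the
    double integral; k = th h makes u(x) > h imply th u(x) >= k. *)
Lemma energy_lower k th h Y : 0 < k -> 0 < th -> th < 1 -> k = th * h ->
  0 < Y -> (mass u q k <= Y%:E)%E -> k `^ (- (q - 1)) * Y <= @hole_max R n ->
  ((@kernel_const R n s * de * (1 - th) ^+ 2 * th `^ la * Y `^ (- al))%:E *
     mass u q h <=
   \int[(mu \x mu)%E]_(z in cross) (pairing u (trunc_pow k de \o u) z)%:E)%E.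
Proof.
move=> k0 th0 th1 kh Y0 FY kb.
set C := @kernel_const R n s * de * _ * _ * _.
have C0 : 0 <= C.
  by rewrite /C /kernel_const !mulr_ge0 ?powR_ge0 ?exprn_ge0 ?subr_ge0// ltW.
set P := pairing u _.
have hpos z : 0 <= pairing u (trunc_pow k de \o u) z.
  by apply: pairing_ge0 => a c; apply: trunc_pow_homo => //; exact: ltW.
have mP : measurable_fun setT (fun z => (P z)%:E).
  apply: measurable_pairing; first exact: um.
  exact: measurableT_comp (measurable_trunc_pow _ _) um.
have mA := measurable_superlevel um h.
pose D := superlevel u h `*` (B : set (Rn R n)).
have mD : measurable D by apply: measurableX => //; exact: measurable_B.
apply: (@le_trans _ _ (\int[(mu \x mu)%E]_(z in D) (P z)%:E)%E); last first.
  apply: ge0_subset_integral.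
  - exact: mD.
  - exact: measurable_cross.
  - exact: measurable_funTS.
  - by move=> z _; rewrite lee_fin; exact: hpos.
  - by move=> z [_ Bz] [_ /=].
have mrP : measurable_fun setT ((fun z => (P z)%:E) \_ D).
  by apply/(measurable_restrictT _ mD); exact: measurable_funTS mP.
rewrite integral_mkcond fubini_tonelli1; last 2 first.
- exact: mrP.
- move=> z; rewrite /patch; case: ifP => _ //; rewrite lee_fin; exact: hpos.
have -> : (C%:E * mass u q h =
    \int[mu]_(x in superlevel u h) (C%:E * (u x `^ (q - 1))%:E))%E.
  rewrite ge0_integralZl_EFin; [by []|exact: mA| |exact: measurable_upow|exact: C0].
  by move=> x _; rewrite lee_fin powR_ge0.
rewrite integral_mkcond.
apply: ge0_le_integral.
- exact: measurableT.
- move=> x _; rewrite /patch; case: ifP => _ //.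
  by rewrite mule_ge0// lee_fin ?powR_ge0.
- apply/(measurable_restrictT _ mA)/measurable_funeM.
  exact: measurable_upow.
- apply: measurable_fun_fubini_tonelli_F.
  + exact: mrP.
  + move=> z; rewrite /patch; case: ifP => _ //; rewrite lee_fin; exact: hpos.
move=> x _; rewrite /fubini_F.
rewrite {1}/patch; case: ifPn => [|_]; last first.
  apply: integral_ge0 => y _; rewrite /patch; case: ifP => _ //.
  by rewrite lee_fin; exact: hpos.
rewrite inE => -[Bx /= hx].
rewrite -EFinM.
have -> : (\int[mu]_y ((fun z => (P z)%:E) \_ D) (x, y) =
           \int[mu]_(y in B) (P (x, y))%:E)%E.
  rewrite [RHS]integral_mkcond; apply: eq_integral => y _; rewrite /patch.
  by congr (if _ then _ else _); apply/idP/idP; rewrite !inE; [case|split].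
apply: inner_lower => //.
by rewrite kh ler_pM2l// ltW.
Qed.

End lower_bound.

(** * Admissible test functions *)

Section test_functions.
Context {R : realType} {n : nat}.
Variable s : R.
Local Notation mu := (@lebesgue R n).
Local Notation p := (n%:R + 2 * s).
Implicit Types (u v : Rn R n -> R) (f : R -> R).

Lemma c_ns_ge0 : 0 <= c_ns R n s.
Proof.
rewrite /c_ns invr_ge0; apply: Rintegral_ge0 => z _.
by rewrite divr_ge0 ?powR_ge0// subr_ge0 cos_le1.
Qed.

Lemma Lnorm2_bounded v M : measurable_fun setT v -> (forall x, `|v x| <= M) ->
  ('N[muB R n]_2%:E[EFin \o v] < +oo)%E.
Proof.
move=> mv vM; rewrite unlock; apply: poweR_lty.
apply: (@le_lt_trans _ _ (\int[muB R n]_x (M `^ 2)%:E)%E).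
  apply: ge0_le_integral.
  - exact: measurableT.
  - by move=> x _; exact: poweR_ge0.
  - have -> : (fun x => (`|(EFin \o v) x| `^ 2)%E) = EFin \o (fun x => `|v x| `^ 2).
      by [].
    apply/measurable_EFinP; apply: (measurableT_comp (measurable_powR 2)).
    exact: measurableT_comp mv.
  - exact: measurable_cst.
  - move=> x _; rewrite lee_fin; apply: ge0_ler_powR => //.
    by rewrite nnegrE (le_trans _ (vM x)).
rewrite integral_cst; last exact: measurableT.
rewrite /muB /= /mrestr setTI.
apply: lte_mul_pinfty; rewrite ?lee_fin ?powR_ge0//.
exact: lebesgue_B_lty.
Qed.

Lemma seminormE u : seminormHB s u =
  (((c_ns R n s / 2)%:E *
    \int[(mu \x mu)%E]_(z in cross) (pairing s u u z)%:E) `^ (2^-1))%E.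
Proof.
congr ((_ * _) `^ _)%E; apply: eq_integral => z _.
by rewrite /pairing real_normK ?num_real// expr2.
Qed.

Lemma seminorm_lty u : (seminormHB s u < +oo)%E ->
  ((c_ns R n s / 2)%:E *
    \int[(mu \x mu)%E]_(z in cross) (pairing s u u z)%:E < +oo)%E.
Proof. by rewrite seminormE; apply: lty_poweRy; rewrite invr_eq0 pnatr_eq0. Qed.

Lemma integral_pairing_le u v w1 w2 L : 0 <= L ->
  measurable_fun setT u -> measurable_fun setT v ->
  measurable_fun setT w1 -> measurable_fun setT w2 ->
  (forall z, 0 <= pairing s w1 w2 z) ->
  (forall z, 0 <= pairing s u v z) ->
  (forall z, pairing s w1 w2 z <= L * pairing s u v z) ->
  (\int[(mu \x mu)%E]_(z in cross) (pairing s w1 w2 z)%:E <=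
   L%:E * \int[(mu \x mu)%E]_(z in cross) (pairing s u v z)%:E)%E.
Proof.
move=> L0 um mv mw1 mw2 w0 u0 wu; rewrite -ge0_integralZl_EFin; last first.
- exact: L0.
- by apply: measurable_funTS; exact: measurable_pairing.
- by move=> z _; rewrite lee_fin.
- exact: measurable_cross.
apply: ge0_le_integral.
- exact: measurable_cross.
- by move=> z _; rewrite lee_fin.
- by apply: measurable_funTS; exact: measurable_pairing.
- by apply: measurable_funeM; apply: measurable_funTS; exact: measurable_pairing.
- by move=> z _; rewrite -EFinM lee_fin.
Qed.

Lemma pairing_sqr_ge0 u z : 0 <= pairing s u u z.
Proof. by rewrite /pairing -expr2 divr_ge0 ?sqr_ge0 ?powR_ge0. Qed.

(** A bounded Lipschitz function of u has an energy controlled by that of u, so the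
    equation may be tested with it, constants included (L = 0). *)
Lemma HB0_comp u f M L : HB0 s u -> measurable_fun setT f -> 0 <= L ->
  (forall t, `|f t| <= M) -> (forall a b, `|f a - f b| <= L * `|a - b|) ->
  HB0 s (f \o u).
Proof.
move=> [um _ su] mf L0 fM fL.
have mfu : measurable_fun setT (f \o u) by exact: measurableT_comp mf um.
split; [exact: mfu|by apply: (Lnorm2_bounded mfu) => x; exact: fM|].
move/seminorm_lty : su => su; rewrite seminormE; apply: poweR_lty.
have h : (\int[(mu \x mu)%E]_(z in cross) (pairing s (f \o u) (f \o u) z)%:E <=
    (L ^+ 2)%:E * \int[(mu \x mu)%E]_(z in cross) (pairing s u u z)%:E)%E.
  apply: (integral_pairing_le _ um um mfu mfu).
  - exact: sqr_ge0.
  - exact: pairing_sqr_ge0.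
  - exact: pairing_sqr_ge0.
  move=> z; rewrite /pairing /= mulrA ler_wpM2r ?invr_ge0 ?powR_ge0//.
  rewrite -!expr2 -exprMn.
  rewrite -[leLHS]real_normK ?num_real// -[leRHS]real_normK ?num_real//.
  by rewrite lerXn2r ?nnegrE// normrM (ger0_norm L0).
have cns0 : (0 <= (c_ns R n s / 2)%:E)%E by rewrite lee_fin divr_ge0// c_ns_ge0.
apply: le_lt_trans (lee_wpmul2l cns0 h) _.
rewrite muleCA; apply: lte_mul_pinfty => //; rewrite lee_fin; exact: sqr_ge0.
Qed.

(** For nondecreasing f the integrand of the form is nonnegative and dominated by L
    times that of the energy of u; the extended integral is therefore finite and
    agrees with its real-valued version. *)
Lemma formHB_homo u f L : HB0 s u -> 0 < c_ns R n s -> measurable_fun setT f ->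
  0 <= L -> {homo f : x y / x <= y} ->
  (forall a b, `|f a - f b| <= L * `|a - b|) ->
  ((c_ns R n s / 2)%:E *
    \int[(mu \x mu)%E]_(z in cross) (pairing s u (f \o u) z)%:E =
   (formHB s u (f \o u))%:E)%E.
Proof.
move=> [um _ su] cns0 mf L0 fh fL.
have mfu : measurable_fun setT (f \o u) by exact: measurableT_comp mf um.
rewrite /formHB [RHS]EFinM; congr (_ * _)%E; rewrite /Rintegral fineK//.
rewrite ge0_fin_numE; last first.
  by apply: integral_ge0 => z _; rewrite lee_fin; exact: pairing_ge0.
have : (\int[(mu \x mu)%E]_(z in cross) (pairing s u (f \o u) z)%:E <=
    L%:E * \int[(mu \x mu)%E]_(z in cross) (pairing s u u z)%:E)%E.
  apply: (integral_pairing_le _ um um um mfu).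
  - exact: L0.
  - by move=> z; exact: pairing_ge0.
  - exact: pairing_sqr_ge0.
  move=> z; rewrite /pairing /= mulrA ler_wpM2r ?invr_ge0 ?powR_ge0//.
  apply: le_trans (ler_norm _) _; rewrite normrM -expr2.
  by rewrite -[in leRHS]real_normK ?num_real// expr2 mulrCA ler_wpM2l.
move=> /le_lt_trans; apply.
apply: lte_mul_pinfty; rewrite ?lee_fin//.
have c20 : 0 < c_ns R n s / 2 by rewrite divr_gt0.
move/seminorm_lty : su; apply: contraTT; rewrite -!leNgt !leye_eq => /eqP ->.
by rewrite gt0_muley ?lte_fin.
Qed.

End test_functions.

(** * Consequences of the weak equation *)

Section solutions.
Context {R : realType} {n : nat}.
Variables s q d : R.
Hypotheses (q2 : 2 < q) (d0 : 0 < d).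
Local Notation mu := (@lebesgue R n).
Variable u : Rn R n -> R.
Hypothesis wu : weak_solution s q d u.

Let HBu : HB0 s u. Proof. by case: wu. Qed.
Let um : measurable_fun setT u. Proof. by case: HBu. Qed.
Let u_ge0 : {ae mu, forall x, 0 <= u x}. Proof. by case: wu. Qed.

Let q1 : 0 < q - 1.
Proof. by rewrite subr_gt0; apply: lt_trans q2; rewrite ltr1n. Qed.

Lemma measurable_mulEFin (f g : Rn R n -> R) D : measurable_fun setT f ->
  measurable_fun setT g -> measurable_fun D (fun x => (f x * g x)%:E).
Proof.
move=> mf mg; apply: measurable_funTS; apply/measurable_EFinP.
exact: measurable_funM.
Qed.

Lemma test_identity v : HB0 s v ->
  mu.-integrable B (EFin \o (fun x => u x `^ (q - 1) * v x)) /\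
  (d * formHB s u v + \int[mu]_(x in B) (u x * v x))%:E =
  (\int[mu]_(x in B) (u x `^ (q - 1) * v x)%:E)%E.
Proof.
move=> hv; have [_ _ /(_ v hv) [iv ->]] := wu; split => //.
rewrite /Rintegral fineK//; apply: integrable_fin_num => //; exact: measurable_B.
Qed.

Definition mass_bound : R := 2 * (2 `^ (q - 2)^-1 * 2 ^+ n).

(** The test function 1 gives int_B u = int_B u^(q-1).  With C^(q-2) = 2 one has
    u <= u^(q-1) / 2 + C, so half of the right-hand side can be absorbed. *)
Lemma mass_le_bound k : (mass u q k <= mass_bound%:E)%E.
Proof.
have h1 : HB0 s ((fun=> 1 : R) \o u).
  apply: (@HB0_comp _ _ _ _ _ 1 0) => //= [t|a b]; first by rewrite normr1.
  by rewrite subrr normr0 mul0r.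
have [iv] := test_identity h1.
have -> : formHB s u ((fun=> 1) \o u) = 0.
  rewrite /formHB /Rintegral (_ : (\int[_]_(z in _) _)%E = 0%E) ?mulr0//.
  by apply: integral0_eq => z _; rewrite /= subrr mulr0 mul0r.
rewrite mulr0 add0r.
set E2 := (X in _ = X); set E1 := Rintegral _ _ _ => EE.
(* [u] may be negative on a null set; [w] is its nonnegative version *)
pose w x : R := Num.max (u x) 0.
have mw : measurable_fun setT w.
  by apply: measurable_maxr => //; exact: measurable_cst.
pose C : R := 2 `^ (q - 2)^-1.
have C0 : 0 < C by rewrite powR_gt0.
have pw x : w x <= 2^-1 * u x `^ (q - 1) + C.
  have p0 : 0 <= 2^-1 * u x `^ (q - 1) by rewrite mulr_ge0 ?powR_ge0.
  rewrite /w ge_max; apply/andP; split; last by rewrite addr_ge0// ltW.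
  have [uC|uC] := leP (u x) C; first by rewrite (le_trans uC)// lerDr.
  have u0 : 0 < u x by exact: lt_trans uC.
  have -> : u x `^ (q - 1) = u x * u x `^ (q - 2).
    rewrite -{2}[u x]powRr1 ?ltW// -powRD ?(gt_eqF u0) ?implybT//.
    by congr (_ `^ _); ring.
  have : 2 <= u x `^ (q - 2).
    have e : 2 = C `^ (q - 2) :> R.
      by rewrite /C -powRrM mulVf ?powRr1// subr_eq0 gt_eqF.
    by rewrite [leLHS]e; apply: ge0_ler_powR; rewrite ?nnegrE ?subr_ge0 ltW.
  by nra.
have E2B : E2 = (\int[mu]_(x in B) (u x `^ (q - 1))%:E)%E.
  by apply: eq_integral => x _; rewrite /= mulr1.
have E2fin : E2 \is a fin_num by rewrite -EE.
have hw : (\int[mu]_(x in B) (w x)%:E <= (2^-1)%:E * E2 + (C * 2 ^+ n)%:E)%E.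
  apply: (@le_trans _ _
    (\int[mu]_(x in B) ((2^-1)%:E * (u x `^ (q - 1))%:E + C%:E))%E).
    apply: ge0_le_integral.
    - exact: measurable_B.
    - by move=> x _; rewrite lee_fin /w le_max lexx orbT.
    - by apply: measurable_funTS; exact/measurable_EFinP.
    - apply: emeasurable_funD; last exact: measurable_cst.
      by apply: measurable_funeM; exact: measurable_upow.
    - by move=> x _; rewrite -EFinM -EFinD lee_fin.
  rewrite ge0_integralD.
  - rewrite ge0_integralZl_EFin.
    + rewrite -E2B leeD2l// integral_cst; last exact: measurable_B.
      rewrite EFinM; apply: lee_wpmul2l; first by rewrite lee_fin ltW.
      exact: lebesgue_B.
    + exact: measurable_B.
    + by move=> x _; rewrite lee_fin powR_ge0.
    + exact: measurable_upow.
    + by [].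
  - exact: measurable_B.
  - by move=> x _; rewrite -EFinM lee_fin mulr_ge0 ?powR_ge0.
  - by apply: measurable_funeM; exact: measurable_upow.
  - by move=> x _; rewrite lee_fin ltW.
  - exact: measurable_cst.
have Iw : (\int[mu]_(x in B) (w x)%:E = \int[mu]_(x in B) (u x * 1)%:E)%E.
  apply: ae_eq_integral.
  - exact: measurable_B.
  - by apply: measurable_funTS; exact/measurable_EFinP.
  - by apply: measurable_mulEFin um _; exact: measurable_cst.
  - by apply: filterS u_ge0 => x ux _; rewrite /w mulr1 max_l.
have wfin : (\int[mu]_(x in B) (w x)%:E)%E \is a fin_num.
  rewrite ge0_fin_numE; first by apply: le_lt_trans hw _; rewrite -EE -EFinM ltry.
  by apply: integral_ge0 => x _; rewrite lee_fin /w le_max lexx orbT.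
have E1w : E1%:E = (\int[mu]_(x in B) (w x)%:E)%E.
  by rewrite Iw /E1 /Rintegral fineK// -Iw.
have hB : (E2 <= (2^-1)%:E * E2 + (C * 2 ^+ n)%:E)%E by rewrite -{1}EE E1w.
apply: (@le_trans _ _ E2).
  rewrite E2B; apply: ge0_subset_integral.
  - exact: measurable_superlevel.
  - exact: measurable_B.
  - exact: measurable_upow.
  - by move=> x _; rewrite lee_fin powR_ge0.
  - by move=> x [].
move: hB; rewrite -(fineK E2fin) -EFinM -EFinD !lee_fin /mass_bound -/C.
lra.
Qed.

Lemma HB0_trunc_pow k de : 0 < k -> 0 < de -> HB0 s (trunc_pow k de \o u).
Proof.
move=> k0 de0.
apply: (@HB0_comp _ _ _ _ _ (k `^ (- de)) (de * k `^ (- de) / k)) => //.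
- exact: measurable_trunc_pow.
- by rewrite divr_ge0 ?mulr_ge0 ?powR_ge0// ltW.
- by move=> t; rewrite ger0_norm ?trunc_pow_le// trunc_pow_ge0// ltW.
- by move=> a b; apply: trunc_pow_lip => //; exact: ltW.
Qed.

Lemma mul_trunc_pow_ge0 k de x : 0 < k -> 0 < de -> 0 <= u x * trunc_pow k de (u x).
Proof.
move=> k0 de0; have [uk|ku] := leP (u x) k; first by rewrite trunc_pow_eq0// mulr0.
by rewrite mulr_ge0 ?trunc_pow_ge0 ?ltW//; exact: lt_trans ku.
Qed.

Lemma test_rhs_le k de : 0 < k -> 0 < de ->
  (\int[mu]_(x in B) (u x `^ (q - 1) * trunc_pow k de (u x))%:E <=
   (k `^ (- de))%:E * mass u q k)%E.
Proof.
move=> k0 de0; have mA := measurable_superlevel um k.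
have -> : ((k `^ (- de))%:E * mass u q k =
    \int[mu]_(x in superlevel u k) ((k `^ (- de))%:E * (u x `^ (q - 1))%:E))%E.
  rewrite ge0_integralZl_EFin;
    [by []|exact: mA| |exact: measurable_upow|exact: powR_ge0].
  by move=> x _; rewrite lee_fin powR_ge0.
have mt : measurable_fun setT (trunc_pow k de \o u).
  exact: measurableT_comp (measurable_trunc_pow _ _) um.
have mf : measurable_fun setT (fun x => (u x `^ (q - 1) * trunc_pow k de (u x))%:E).
  apply: measurable_mulEFin mt.
  exact: (measurableT_comp (measurable_powR (q - 1)) um).
rewrite integral_mkcond [leRHS]integral_mkcond.
apply: ge0_le_integral.
- exact: measurableT.
- move=> x _; rewrite /patch; case: ifP => _ //.
  by rewrite lee_fin mulr_ge0 ?powR_ge0 ?trunc_pow_ge0// ltW.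
- by apply/(measurable_restrictT _ (@measurable_B R n)); exact: measurable_funTS.
- by apply/(measurable_restrictT _ mA)/measurable_funeM; exact: measurable_upow.
move=> x _; rewrite /patch.
have [xA|xA] := pselect (superlevel u k x).
  rewrite !mem_set//; last by case: xA.
  by rewrite -EFinM lee_fin mulrC ler_wpM2r ?powR_ge0// trunc_pow_le.
rewrite (memNset xA); case: ifPn => // /set_mem Bx.
rewrite trunc_pow_eq0 ?mulr0// leNgt; apply/negP => ku; exact: xA.
Qed.

(** Without the nonlocal term, testing with a nondecreasing v that vanishes for
    u <= 1 yields int_B (u^(q-1) - u) v = 0.  The integrand is nonnegative, and
    bounded below by a positive constant where u > 2. *)
Lemma degenerate_superlevel : c_ns R n s = 0 -> mu (superlevel u 2) = 0%E.
Proof.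
move=> cns0; have [iv] := test_identity (HB0_trunc_pow ltr01 ltr01).
rewrite /formHB cns0 !mul0r mulr0 add0r.
set E2 := (X in _ = X); set E1 := Rintegral _ _ _ => EE.
have mt : measurable_fun setT (trunc_pow 1 1 \o u).
  exact: measurableT_comp (measurable_trunc_pow _ _) um.
pose eta : R := 2 * (2 `^ (q - 2) - 1) * trunc_pow 1 1 2.
have p1 : 1 < 2 `^ (q - 2) :> R.
  rewrite [ltLHS](_ : 1 = 1 `^ (q - 2)); last by rewrite powR1.
  apply: gt0_ltr_powR; rewrite ?nnegrE ?subr_gt0//.
  by rewrite ltr1n.
have T2 : 0 < trunc_pow 1 1 2 :> R.
  rewrite /trunc_pow powR1 max_r ?ler1n// powR_inv1//.
  by rewrite subr_gt0 invf_lt1 ?ltr1n.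
have eta0 : 0 < eta by rewrite !mulr_gt0// subr_gt0.
have mA := measurable_superlevel um 2.
have uv0 x : 0 <= u x * trunc_pow 1 1 (u x) by exact: mul_trunc_pow_ge0.
have muv : measurable_fun B (fun x => (u x * trunc_pow 1 1 (u x))%:E).
  exact: measurable_mulEFin.
have muqv : measurable_fun B (fun x => (u x `^ (q - 1) * trunc_pow 1 1 (u x))%:E).
  apply: measurable_mulEFin mt.
  exact: (measurableT_comp (measurable_powR (q - 1)) um).
have pt x : B x -> u x * trunc_pow 1 1 (u x) + eta * \1_(superlevel u 2) x <=
    u x `^ (q - 1) * trunc_pow 1 1 (u x).
  move=> Bx; rewrite indicE.
  have T0 : 0 <= trunc_pow 1 1 (u x) by rewrite trunc_pow_ge0.
  have [u2|u2] := leP (u x) 2.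
    rewrite memNset ?mulr0 ?addr0; last by case=> _ /=; rewrite ltNge u2.
    have [u1|u1] := leP (u x) 1; first by rewrite trunc_pow_eq0// !mulr0.
    by rewrite ler_wpM2r// le1r_powR ?lerBrDr// ltW.
  rewrite mem_set// mulr1.
  have u0 : 0 < u x by apply: lt_trans u2.
  have -> : u x `^ (q - 1) = u x * u x `^ (q - 2).
    rewrite -{2}[u x]powRr1 ?ltW// -powRD ?(gt_eqF u0) ?implybT//.
    by congr (_ `^ _); ring.
  have hp : 2 `^ (q - 2) <= u x `^ (q - 2).
    by apply: ge0_ler_powR; rewrite ?nnegrE ?subr_ge0 ltW.
  have hT : trunc_pow 1 1 2 <= trunc_pow 1 1 (u x).
    by apply: trunc_pow_homo => //; exact: ltW.
  have h1 : 2 * (2 `^ (q - 2) - 1) <= u x * (u x `^ (q - 2) - 1).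
    by apply: ler_pM => //; [rewrite subr_ge0 ltW|exact: ltW|rewrite lerD2r].
  have h2 : eta <= u x * (u x `^ (q - 2) - 1) * trunc_pow 1 1 (u x).
    by apply: ler_pM => //; [rewrite mulr_ge0// subr_ge0 ltW|exact: ltW].
  lra.
have E2fin : E2 \is a fin_num by rewrite -EE.
have mi : measurable_fun B (fun x => (\1_(superlevel u 2) x)%:E : \bar R).
  by apply/measurable_EFinP; exact: measurable_indic.
have hE : ((\int[mu]_(x in B) (u x * trunc_pow 1 1 (u x))%:E) +
    eta%:E * mu (superlevel u 2) <= E2)%E.
  have -> : superlevel u 2 = superlevel u 2 `&` B by rewrite setIidl// => x [].
  rewrite -(integral_indic mu (@measurable_B R n) mA) -ge0_integralZl_EFin; last first.
  - exact: ltW.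
  - exact: mi.
  - by move=> x _; rewrite lee_fin.
  - exact: measurable_B.
  rewrite -ge0_integralD; last first.
  - exact: measurable_funeM.
  - by move=> x _; apply: mule_ge0; rewrite lee_fin// ltW.
  - exact: muv.
  - by move=> x _; rewrite lee_fin.
  - exact: measurable_B.
  apply: ge0_le_integral.
  - exact: measurable_B.
  - by move=> x _; apply: adde_ge0; [|apply: mule_ge0]; rewrite lee_fin// ltW.
  - by apply: (emeasurable_funD muv); exact: measurable_funeM.
  - exact: muqv.
  - by move=> x Bx; rewrite -EFinM -EFinD lee_fin pt.
have I0 : (0 <= \int[mu]_(x in B) (u x * trunc_pow 1 1 (u x))%:E)%E.
  by apply: integral_ge0 => x _; rewrite lee_fin.
have Ifin : (\int[mu]_(x in B) (u x * trunc_pow 1 1 (u x))%:E)%E \is a fin_num.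
  rewrite ge0_fin_numE//.
  apply: le_lt_trans (_ : (E2 < +oo)%E); last by rewrite -EE ltry.
  by apply: le_trans hE; rewrite leeDl//; apply: mule_ge0 => //; rewrite lee_fin ltW.
have E1E : E1%:E = (\int[mu]_(x in B) (u x * trunc_pow 1 1 (u x))%:E)%E.
  by rewrite /E1 /Rintegral fineK.
move: hE; rewrite -EE -E1E -[leRHS]adde0 leeD2lE// => h.
apply/eqP; rewrite eq_le measure_ge0 andbT.
by rewrite -(@lee_pmul2l _ eta%:E) ?lte_fin// mule0.
Qed.

End solutions.

(** * Decay of the mass and De Giorgi iteration *)

Section mass_decay.
Context {R : realType} {n : nat}.
Hypothesis n0 : (0 < n)%N.
Variables s q d de : R.
Hypotheses (s0 : 0 < s) (q2 : 2 < q) (d0 : 0 < d).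
Local Notation mu := (@lebesgue R n).
Local Notation al := (2 * s / n%:R).
Local Notation la := ((q - 1) * al).
Hypothesis deE : de = la - (q - 2).
Hypothesis de0 : 0 < de.
Hypothesis c_ns0 : 0 < c_ns R n s.
Variable u : Rn R n -> R.
Hypothesis wu : weak_solution s q d u.

Definition decay_const : R := 2 / (c_ns R n s * @kernel_const R n s * de).

Lemma kernel_const_gt0 : 0 < @kernel_const R n s.
Proof. by rewrite /kernel_const mulr_gt0// powR_gt0// ltr0n. Qed.

Lemma decay_const_gt0 : 0 < decay_const.
Proof.
rewrite /decay_const divr_gt0//; apply: mulr_gt0 de0.
by apply: mulr_gt0 c_ns0 _; exact: kernel_const_gt0.
Qed.

(** The weak equation tested with [trunc_pow k de \o u]: the term int_B u v is
    nonnegative and can be dropped, the right-hand side is at most k^-de Y, and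
    [energy_lower] bounds the form from below. *)
Lemma mass_step k th h Y : 0 < k -> 0 < th -> th < 1 -> k = th * h -> 0 < Y ->
  (mass u q k <= Y%:E)%E -> k `^ (- (q - 1)) * Y <= @hole_max R n ->
  (mass u q h <= (decay_const / d *
     (((1 - th) ^+ 2 * th `^ la)^-1 * k `^ (- de) * Y `^ (1 + al)))%:E)%E.
Proof.
move=> k0 th0 th1 kh Y0 FY kb.
have [HBu _ _] := wu; have [um _ _] := HBu.
have Lle : 0 <= de * k `^ (- de) / k.
  by rewrite divr_ge0 ?mulr_ge0 ?powR_ge0// ltW.
have := formHB_homo HBu c_ns0 (@measurable_trunc_pow R k de) Lle
  (fun a b => @trunc_pow_homo R k de a b k0 (ltW de0))
  (fun a b => @trunc_pow_lip R k de a b k0 (ltW de0)).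
set I := (\int[_]_(z in _) _)%E => IE.
have EI := energy_lower n0 s0 q2 deE de0 um k0 th0 th1 kh Y0 FY kb.
have [_ tE] := test_identity wu (HB0_trunc_pow wu k0 de0).
have rE := test_rhs_le wu k0 de0.
have form_le : ((d * formHB s u (trunc_pow k de \o u))%:E <= (k `^ (- de) * Y)%:E)%E.
  apply: (@le_trans _ _ ((k `^ (- de))%:E * mass u q k)%E); last first.
    by rewrite EFinM lee_wpmul2l// lee_fin powR_ge0.
  apply: le_trans rE; rewrite -[leRHS]tE lee_fin lerDl.
  by apply: Rintegral_ge0 => x _; exact: (mul_trunc_pow_ge0 u).
move: EI; set c1 := kernel_const s * _ * _ * _ * _ => EI.
have c10 : 0 < c1.
  do 4![apply: mulr_gt0; rewrite ?powR_gt0 ?exprn_gt0 ?subr_gt0//].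
  exact: kernel_const_gt0.
pose m := d * (c_ns R n s / 2) * c1.
have m0 : 0 < m by apply: mulr_gt0 c10; rewrite mulr_gt0// divr_gt0.
have key : (m%:E * mass u q h <= (k `^ (- de) * Y)%:E)%E.
  apply: le_trans form_le; rewrite [leRHS]EFinM -IE muleA -EFinM.
  rewrite /m [X in (X * _ <= _)%E]EFinM -muleA.
  by apply: lee_wpmul2l EI; rewrite lee_fin mulr_ge0 ?divr_ge0// ltW.
rewrite -(@lee_pmul2l _ m%:E) ?lte_fin//; apply: le_trans key _.
rewrite -EFinM lee_fin le_eqVlt; apply/orP; left; apply/eqP.
rewrite /m /c1 /decay_const (@powRD _ Y 1) ?(gt_eqF Y0) ?implybT//.
rewrite powRr1 ?(ltW Y0)// (powRN Y).
have c00 := kernel_const_gt0.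
have ? : Y `^ al != 0 by rewrite gt_eqF// powR_gt0.
have ? : th `^ la != 0 by rewrite gt_eqF// powR_gt0.
have ? : 1 - th != 0 by rewrite gt_eqF// subr_gt0.
field; rewrite ?(gt_eqF c00) ?(gt_eqF c_ns0) ?(gt_eqF d0) ?(gt_eqF de0).
by do ![apply/andP; split => //].
Qed.

End mass_decay.

Section iteration.
Context {R : realType}.

Lemma geometric_le0 (M eta r : R) : 0 < M -> 0 < eta -> eta < 1 ->
  (forall j, r <= M * eta ^+ j) -> r <= 0.
Proof.
move=> M0 eta0 eta1 h.
have c : (fun j => M * eta ^+ j) @ \oo --> (M * 0 : R).
  by apply: cvgMr; apply: cvg_expr; rewrite ger0_norm// ltW.
rewrite mulr0 in c.
rewrite -(cvg_lim _ c)//; apply: limr_ge; first exact: cvgP c.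
exact: nearW.
Qed.

(** Along k_j = k0 (2 - 2^-j) one shows F(k_j) <= M eta^j with eta = 4^(-1/al).
    Passing from j to j + 1 costs (1 - th)^-2 <= 16 4^j, and Y^al = M^al eta^(j al)
    supplies exactly the compensating factor 4^-j. *)
Lemma de_giorgi (F : R -> \bar R) (M al la de C k0 : R) :
  0 < M -> 0 < al -> 0 <= la -> 0 < de -> 0 < C -> 0 < k0 ->
  (forall t, 0%E <= F t)%E ->
  (forall t t' : R, t <= t' -> (F t' <= F t)%E) ->
  (F k0 <= M%:E)%E ->
  (forall k th h Y, k0 <= k -> 0 < th -> th < 1 -> k = th * h -> 0 < Y ->
    Y <= M -> (F k <= Y%:E)%E ->
    (F h <= (C * (((1 - th) ^+ 2 * th `^ la)^-1 * k `^ (- de) *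
      Y `^ (1 + al)))%:E)%E) ->
  C * (16 * 2 `^ la * M `^ al * 4 `^ al^-1) <= k0 `^ de ->
  F (2 * k0) = 0%E.
Proof.
move=> M0 al0 la0 de0 C0 k00 F0 Fmon FM step hk0.
pose eta : R := 4 `^ (- al^-1).
have eta0 : 0 < eta by rewrite powR_gt0.
have eta1 : eta < 1.
  rewrite /eta powRN invf_lt1 ?powR_gt0//.
  rewrite [ltLHS](_ : 1 = 1 `^ al^-1); last by rewrite powR1.
  by apply: gt0_ltr_powR; rewrite ?nnegrE ?invr_gt0// ltr1n.
pose kk j : R := k0 * (2 - 2^-1 ^+ j).
have e0 j : 0 < 2^-1 ^+ j :> R by rewrite exprn_gt0.
have e1 j : 2^-1 ^+ j <= 1 :> R by rewrite exprn_ile1// invf_le1 ?ler1n.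
have main j : (F (kk j) <= (M * eta ^+ j)%:E)%E.
  elim: j => [|j IH].
    by rewrite /kk !expr0 mulr1 (_ : 2 - 1 = 1) ?mulr1//; ring.
  have kj : k0 <= kk j.
    by rewrite /kk ler_peMr ?(ltW k00)//; have := e1 j; lra.
  have kS : kk j.+1 = kk j + k0 * 2^-1 ^+ j.+1 by rewrite /kk exprS; field.
  have kSle : kk j.+1 <= 2 * k0.
    by rewrite /kk mulrC ler_pM2r//; have := e0 j.+1; lra.
  have kj0 : 0 < kk j by exact: lt_le_trans kj.
  have kS0 : 0 < kk j.+1 by rewrite kS addr_gt0// mulr_gt0.
  pose th := kk j / kk j.+1.
  have th0 : 0 < th by rewrite divr_gt0.
  have th12 : 2^-1 <= th by rewrite /th ler_pdivlMr//; lra.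
  have th1E : 1 - th = k0 * 2^-1 ^+ j.+1 / kk j.+1.
    rewrite /th -[X in X - _](mulfV (lt0r_neq0 kS0)) -mulrBl kS.
    by congr (_ / _); ring.
  have th1 : 2^-1 ^+ j.+2 <= 1 - th.
    rewrite th1E ler_pdivlMr// [2^-1 ^+ j.+2]exprS mulrC mulrA ler_pM2r//.
    by rewrite mulrC; lra.
  have th1' : 0 < 1 - th by exact: lt_le_trans th1.
  pose Y := M * eta ^+ j.
  have Y0 : 0 < Y by rewrite mulr_gt0// exprn_gt0.
  have YM : Y <= M by rewrite /Y ger_pMr// exprn_ile1// ltW.
  have := step (kk j) th (kk j.+1) Y kj th0 _ _ Y0 YM IH.
  rewrite -subr_gt0 => /(_ th1').
  rewrite /th divfK ?(gt_eqF kS0)// -/th => /(_ erefl) /le_trans; apply.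
  rewrite lee_fin.
  have f1 : ((1 - th) ^+ 2 * th `^ la)^-1 <= 16 * 4 ^+ j * 2 `^ la.
    rewrite invfM; apply: ler_pM.
    - by rewrite invr_ge0 exprn_ge0// ltW.
    - by rewrite invr_ge0 powR_ge0.
    - have -> : 16 * 4 ^+ j = ((2^-1 ^+ j.+2) ^+ 2)^-1 :> R.
        rewrite -exprM mulnC exprM -exprVn (_ : (2^-1 ^+ 2)^-1 = 4); last by field.
        by rewrite !exprS; ring.
      rewrite lef_pV2 ?posrE ?exprn_gt0//.
      by rewrite lerXn2r ?nnegrE ?(ltW th1') ?(ltW (e0 _)).
    - have -> : 2 `^ la = (2^-1 `^ la)^-1 :> R.
        by rewrite -powRN -[in RHS]powR_inv1// -powRrM mulN1r opprK.
      rewrite lef_pV2 ?posrE ?powR_gt0//.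
      by apply: ge0_ler_powR; rewrite ?nnegrE ?(ltW th0)// invr_ge0.
  have f2 : kk j `^ (- de) <= k0 `^ (- de) by apply: powRN_le => //; exact: ltW.
  have f3 : Y `^ (1 + al) = Y * (M `^ al * (4 ^+ j)^-1).
    rewrite powRD ?(gt_eqF Y0) ?implybT// powRr1 ?(ltW Y0)//; congr (_ * _).
    rewrite /Y powRM ?(ltW M0) ?exprn_ge0 ?(ltW eta0)//; congr (_ * _).
    rewrite -powR_mulrn ?(ltW eta0)// /eta -!powRrM.
    have -> : - al^-1 * (j%:R * al) = - j%:R by field; rewrite gt_eqF.
    by rewrite powR_invn.
  apply: (@le_trans _ _
    (C * (16 * 4 ^+ j * 2 `^ la * k0 `^ (- de) * Y `^ (1 + al)))).
    rewrite ler_pM2l// ler_wpM2r ?powR_ge0//.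
    by apply: ler_pM => //; rewrite ?invr_ge0 ?mulr_ge0 ?powR_ge0// ?exprn_ge0// ltW.
  rewrite f3.
  have -> : C * (16 * 4 ^+ j * 2 `^ la * k0 `^ (- de) * (Y * (M `^ al / 4 ^+ j))) =
     Y * (C * (16 * 2 `^ la * M `^ al) * k0 `^ (- de)).
    by field; rewrite expf_neq0.
  have -> : M * eta ^+ j.+1 = Y * eta by rewrite /Y exprSr mulrA.
  rewrite ler_pM2l//.
  have k0p : 0 < k0 `^ de by rewrite powR_gt0.
  rewrite powRN ler_pdivrMr//.
  have e4 : 0 < 4 `^ al^-1 :> R by rewrite powR_gt0.
  rewrite /eta powRN -ler_pdivrMl ?invr_gt0// invrK mulrC.
  by apply: le_trans hk0; rewrite le_eqVlt; apply/orP; left; apply/eqP; ring.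
have fle j : (F (2 * k0)%R <= (M * eta ^+ j)%:E)%E.
  apply: le_trans (main j); apply: Fmon.
  by rewrite /kk mulrC ler_pM2r//; have := e0 j; lra.
have Ffin : F (2 * k0) \is a fin_num.
  by rewrite ge0_fin_numE//; apply: le_lt_trans (fle 0%N) _; rewrite ltry.
apply/eqP; rewrite eq_le F0 andbT -(fineK Ffin) lee_fin.
apply: (geometric_le0 M0 eta0 eta1) => j.
by rewrite -lee_fin fineK.
Qed.

End iteration.

(** * The estimate *)

Section conclusion.
Context {R : realType} {n : nat}.
Local Notation mu := (@lebesgue R n).

(** The exceptional null set where u < 0 is added to {u > t}. *)
Lemma Linfty_le (u : Rn R n -> R) (t : R) : 0 <= t -> measurable_fun setT u ->
  {ae mu, forall x, 0 <= u x} -> mu (superlevel u t) = 0%E ->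
  ('N[muB R n]_+oo[EFin \o u] <= t%:E)%E.
Proof.
move=> t0 um [N [mN N0 uN]] st0; rewrite unlock; case: ifPn => // _.
apply: ereal_inf_lbound => /=.
have mt : measurable [set x | t < u x].
  have -> : [set x | t < u x] = u @^-1` `]t, +oo[%classic.
    by apply/seteqP; split => x; rewrite /= in_itv/= andbT.
  by rewrite -[X in measurable X]setTI; apply: um => //; exact: measurable_itv.
exists (N `|` [set x | t < u x]); split.
- exact: measurableU.
- rewrite /muB /= /mrestr setIUl; apply/eqP; rewrite eq_le measure_ge0 andbT.
  apply: le_trans (measureU2 _ _ _) _.
  + by apply: measurableI => //; exact: measurable_B.
  + by apply: measurableI => //; exact: measurable_B.
  + rewrite [X in (_ + X)%E](_ : _ = 0%E) ?adde0; last by rewrite setIC.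
    rewrite -N0; apply: le_measure; rewrite ?inE//.
    by apply: measurableI => //; exact: measurable_B.
- move=> x /= ut; have [ux|/uN ?] := pselect (0 <= u x); last by left.
  right; rewrite /= ltNge; apply/negP => h; apply: ut.
  by rewrite lee_fin ger0_norm.
Qed.

Lemma superlevel_null q (u : Rn R n -> R) (t : R) : measurable_fun setT u ->
  2 < q -> 0 < t ->
  mass u q t = 0%E -> mu (superlevel u t) = 0%E.
Proof.
move=> um q2 t0 m0; apply/eqP; rewrite eq_le measure_ge0 andbT.
have := superlevel_le um q2 t0 (_ : (mass u q t <= 0%:E)%E).
by rewrite m0 mulr0; apply.
Qed.

(** The subcriticality q - 1 < n / (n - 2s) is n de > 0 in disguise. *)
Lemma subcritical_exponent (s q : R) : (0 < n)%N -> 0 < s -> 2 < q ->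
  (q%:E < (crit_exp n s + 2%:E) * (2^-1)%:E)%E ->
  let de := (q - 1) * (2 * s / n%:R) - (q - 2) in
  0 < de /\ de^-1 <= Lambda n s q.
Proof.
move=> n0 s0 q2; rewrite /Lambda /crit_exp.
have n0' : 0 < n%:R :> R by rewrite ltr0n.
have [sn|sn] := ltP s (n%:R / 2).
  have ns : 0 < n%:R - 2 * s by lra.
  rewrite -EFinD -EFinM lte_fin => qr.
  have deE : (q - 1) * (2 * s / n%:R) - (q - 2) =
      (2 * n%:R / (n%:R - 2 * s) - 2 * (q - 1)) * (n%:R - 2 * s) / (2 * n%:R).
    by field; rewrite !gt_eqF.
  have de0 : 0 < (q - 1) * (2 * s / n%:R) - (q - 2).
    by rewrite deE divr_gt0 ?mulr_gt0//; lra.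
  have LE : 2 * n%:R / (n%:R - 2 * s) / (2 * n%:R / (n%:R - 2 * s) - 2 * (q - 1)) =
      ((q - 1) * (2 * s / n%:R) - (q - 2))^-1.
    rewrite deE; have : 2 * n%:R / (n%:R - 2 * s) - 2 * (q - 1) != 0.
      by rewrite gt_eqF//; lra.
    set X := 2 * n%:R / _ - _ => X0.
    by field; rewrite X0 !gt_eqF.
  by rewrite LE.
move=> _; have h : 1 <= 2 * s / n%:R by rewrite ler_pdivlMr// mul1r; lra.
have de1 : 1 <= (q - 1) * (2 * s / n%:R) - (q - 2).
  have : (q - 1) * 1 <= (q - 1) * (2 * s / n%:R) by rewrite ler_wpM2l//; lra.
  lra.
have de0 : 0 < (q - 1) * (2 * s / n%:R) - (q - 2) by lra.
by split => //; rewrite invf_le1.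
Qed.

(** Only for d < 1 does the size of the exponent matter, and there b >= a helps. *)
Lemma powR_max_le (d a b : R) : 0 < d -> 0 <= a -> a <= b ->
  d `^ (- a) <= Num.max 1 (1 / d `^ b).
Proof.
move=> d0 a0 ab; rewrite le_max div1r -powRN.
have [d1|d1] := leP d 1.
  by apply/orP; right; apply: ger_powR; rewrite ?d0// lerN2.
apply/orP; left; rewrite powRN invf_le1 ?powR_gt0//.
by rewrite -(powRr0 d); apply: ler_powR => //; exact: ltW.
Qed.

End conclusion.

Theorem theorem1p2 (R : realType) (n : nat) (s q : R) :
  0 < s -> s < 1 -> (1 <= n)%N ->
  2 < q -> (q%:E < (crit_exp n s + 2%:E) * (2^-1)%:E)%E ->
  exists K : R, 0 < K /\
    forall (d : R) (u : Rn R n -> R), 0 < d -> weak_solution s q d u ->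
      ('N[muB R n]_+oo[EFin \o u] <=
       (K * Num.max 1 (1 / d `^ Lambda n s q))%:E)%E.
Proof.
move=> s0 _ n0 q2 qcrit.
have [de0 deL] := subcritical_exponent n0 s0 q2 qcrit.
set al := 2 * s / n%:R in de0 deL *; set de := _ - _ in de0 deL *.
set la := (q - 1) * al in de0 deL *.
have al0 : 0 < al by rewrite divr_gt0 ?mulr_gt0 ?ltr0n.
have q10 : 0 < q - 1 by lra.
have la0 : 0 <= la by rewrite mulr_ge0// ltW.
set M := @mass_bound R n q.
have M0 : 0 < M by rewrite /M /mass_bound !mulr_gt0 ?powR_gt0 ?exprn_gt0.
have b0 : 0 < @hole_max R n by exact: hole_max_gt0.
pose C1 := @decay_const R n s de * (16 * 2 `^ la * M `^ al * 4 `^ al^-1).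
have C10 : 0 <= C1.
  apply: mulr_ge0; last by rewrite !mulr_ge0 ?powR_ge0.
  rewrite /decay_const divr_ge0// mulr_ge0 ?(ltW de0)// mulr_ge0 ?c_ns_ge0//.
  exact/ltW/kernel_const_gt0.
(* above [k1] the superlevel sets are small enough for [mass_step] *)
pose k1 : R := (M / @hole_max R n) `^ (q - 1)^-1.
pose K1 : R := 1 + k1 + C1 `^ de^-1.
have K11 : 1 <= K1 by rewrite /K1 -addrA lerDl addr_ge0 ?powR_ge0.
exists (2 * K1); split; first by lra.
move=> d u d0 wu; have [[um _ _] u0 _] := wu.
set mx := Num.max 1 _.
have mx1 : 1 <= mx by rewrite /mx le_max lexx.
have c_ge0 := @c_ns_ge0 R n s.
have K10 : 0 <= K1 by exact: le_trans K11.
have mx0 : 0 <= mx by exact: le_trans mx1.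
pose k0 := K1 * mx.
have k01 : 1 <= k0 by rewrite -[leLHS]mulr1 ler_pM.
have k00 : 0 < k0 by exact: lt_le_trans k01.
have kE : 2 * K1 * mx = 2 * k0 by rewrite /k0 mulrA.
rewrite kE; have [cns0|cns0] := eqVneq (c_ns R n s) 0.
  apply: (@le_trans _ _ 2%:E); last by rewrite lee_fin; lra.
  by apply: Linfty_le => //; exact: (degenerate_superlevel q2 wu).
have {cns0 c_ge0}cns0 : 0 < c_ns R n s by rewrite lt_neqAle eq_sym cns0.
apply: Linfty_le => //; first by lra.
apply: (superlevel_null um q2); first by lra.
apply: (@de_giorgi R (mass u q) M al la de (decay_const (n:=n) s de / d) k0) => //.
- by rewrite divr_gt0// decay_const_gt0.
- by move=> t; exact: mass_ge0.
- by move=> t t' tt'; exact: mass_le.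
- exact: (mass_le_bound q2 wu).
- move=> k th h Y kk0 th0 th1 kh Y0 YM FY.
  have k0' : 0 < k by exact: lt_le_trans kk0.
  apply: (mass_step n0 s0 q2 d0 _ de0 cns0 wu k0' th0 th1 kh Y0 FY) => //.
  rewrite powRN mulrC ler_pdivrMr ?powR_gt0//; apply: (le_trans YM).
  rewrite mulrC -ler_pdivrMr//.
  have -> : M / @hole_max R n = k1 `^ (q - 1).
    by rewrite /k1 -powRrM mulVf ?gt_eqF// powRr1// divr_ge0// ltW.
  apply: ge0_ler_powR; rewrite ?nnegrE ?powR_ge0 ?(ltW q10) ?(ltW k0')//.
  apply: le_trans kk0; apply: (@le_trans _ _ K1).
    by rewrite /K1 -addrA addrCA lerDl addr_ge0 ?powR_ge0.
  by rewrite /k0 ler_peMr// (le_trans ler01).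
- rewrite mulrAC -/C1.
  have -> : C1 / d = (C1 `^ de^-1 * d `^ (- de^-1)) `^ de.
    rewrite powRM ?powR_ge0// -!powRrM mulVf ?gt_eqF// powRr1//.
    rewrite mulNr mulVf ?gt_eqF//.
    by rewrite powR_inv1// ltW.
  apply: ge0_ler_powR; rewrite ?nnegrE ?mulr_ge0 ?powR_ge0 ?(ltW de0) ?(ltW k00)//.
  rewrite /k0; apply: ler_pM; rewrite ?powR_ge0//.
    by rewrite /K1 lerDr addr_ge0 ?powR_ge0.
  by apply: powR_max_le => //; rewrite invr_ge0 ltW.
Qed.
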